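(* Let $\mathbf r=\mathbf r(t)$, $t\in(-\infty,\infty)$, be a solution of the Kepler problem $\ddot{\mathbf r}=-\frac{k\mathbf r}{r^3}$ with energy $h<0$ and angular momentum $\mathbf l\neq\mathbf 0$, and assume that the equality $h=-\frac{m^3k^2}{2l^2}$ does not hold (i.e. the orbit is not a circle). Let $\mathbf A$ be its Laplace-Runge-Lenz vector. Let $0<\theta<\pi$, $\rho=\tan(\frac{\theta}{2})$, and let $\beta$, $\alpha$ and $\epsilon$ be given by $$\epsilon=\pm\frac{l}{m^2k\rho},\qquad \beta^2=\frac{-1}{2mh-\epsilon^{-2}},\qquad \alpha=\frac{1+\epsilon^{-1}|\beta|}{2mh},$$ so that the two choices of the sign of $\epsilon$ give two choices of $\alpha$. Then there are 4 orbit cones: for each of the two choices of $\alpha$ there are two (orbit) cones of bloom $\theta$ with axis passing through $\alpha\mathbf A$. One has vertex at $\alpha\mathbf A+|\epsilon|(\mathbf l+|\beta|\mathbf A)$ and the other has vertex at $\alpha\mathbf A-|\epsilon|(\mathbf l-|\beta|\mathbf A)$.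
   Context: Here $\mathbf r(t)\in\mathbb R^3\setminus\{\mathbf 0\}$ is the position of a body of mass $m>0$ and $k>0$ is a constant. The magnitude of a bold vector is denoted by the same letter in normal typeface, and dots denote time derivatives. The momentum is $\mathbf p=m\dot{\mathbf r}$; the angular momentum $\mathbf l=\mathbf r\times\mathbf p$ and the energy $h=\frac{p^2}{2m}-\frac{mk}{r}$ are constant in time along solutions. The Laplace-Runge-Lenz vector is $\mathbf A=\mathbf p\times\mathbf l-m^2k\frac{\mathbf r}{r}$, which is also constant in time along solutions. Points of space are identified with their position vectors relative to the origin (the source of the force). A cone means a right circular (double) cone: given a line (the axis) and a point $V$ on it (the vertex), the cone is the locus of points $Q$ (together with $V$) such that the smaller positive angle between the line $QV$ and the axis has a fixed value in $(0,\pi/2)$; its bloom $\theta\in(0,\pi)$ is twice this fixed angle. An orbit cone is a cone on whose surface the solution $\mathbf r(t)$ lies for all time.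
   Formalization: The printed vertices are wrong when ε>0; the formal statement replaces |ε| by −ε in both vertex formulas, giving vertices αA−ε(l+|β|A) and αA+ε(l−|β|A), which agree with the printed ones when ε<0. *)

(* Defs.v *)
From HB Require Import structures.
From mathcomp Require Import all_boot all_order all_algebra.
From mathcomp Require Import all_classical all_reals all_analysis.

Set Implicit Arguments.
Unset Strict Implicit.
Unset Printing Implicit Defensive.

Import Order.TTheory GRing.Theory Num.Theory.
Import numFieldNormedType.Exports.

Local Open Scope classical_set_scope.
Local Open Scope ring_scope.

Section Vectors.
Context {R : realType}.
Implicit Types u v : 'rV[R]_3.

Definition dotv u v : R := (u *m v^T) 0 0.

(* The library norm `|u| on 'rV[R]_3 is the sup norm, hence this one. *)
Definition enorm u : R := Num.sqrt (dotv u u).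

(* The indices i + 1 and i + 2 are taken modulo 3. *)
Definition crossv u v : 'rV[R]_3 :=
  \row_(i < 3) (u 0 (i + 1) * v 0 (i + 2%:R) - u 0 (i + 2%:R) * v 0 (i + 1)).

End Vectors.

Section Kepler.
Context {R : realType}.
Implicit Types (m k t : R) (r : R -> 'rV[R]_3).

Definition kepler_solution k r : Prop :=
  forall t, [/\ r t != 0, derivable r t 1, derivable (derive1 r) t 1 &
    derive1 (derive1 r) t = - (k / enorm (r t) ^+ 3) *: r t].

Definition momentum m r t : 'rV[R]_3 := m *: derive1 r t.

Definition angular_momentum m r t : 'rV[R]_3 := crossv (r t) (momentum m r t).

Definition energy m k r t : R :=
  enorm (momentum m r t) ^+ 2 / (2 * m) - m * k / enorm (r t).

Definition lrl_vector m k r t : 'rV[R]_3 :=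
  crossv (momentum m r t) (angular_momentum m r t)
  - (m ^+ 2 * k / enorm (r t)) *: r t.

End Kepler.

Section Cones.
Context {R : realType}.
Implicit Types (P V Q u v A : 'rV[R]_3) (C D : set 'rV[R]_3) (theta : R).

Definition line P u : set 'rV[R]_3 := range (fun s : R => P + s *: u).

(* The angle in [0, pi / 2] between two lines with nonzero directions u, v. *)
Definition line_angle u v : R := acos (`|dotv u v| / (enorm u * enorm v)).

Definition cone V u theta : set 'rV[R]_3 :=
  [set Q | Q = V \/ (Q <> V /\ line_angle (Q - V) u = theta / 2)].

(* The set C is a right circular double cone with vertex V, axis D and bloom
   theta. *)
Definition is_cone C V D theta : Prop :=
  0 < theta < pi /\
  exists2 u, u != 0 & D = line V u /\ C = cone V u theta.

Definition lies_on (r : R -> 'rV[R]_3) C : Prop := forall t, C (r t).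

Definition orbit_cones r theta : set (set 'rV[R]_3) :=
  [set C | lies_on r C /\ exists V D, is_cone C V D theta].

Definition orbit_cones_through r theta P : set (set 'rV[R]_3) :=
  [set C | lies_on r C /\ exists V D, is_cone C V D theta /\ D P].

End Cones.

(* Main.v *)
Require Import Defs.
From HB Require Import structures.
From mathcomp Require Import all_boot all_order all_algebra.
From mathcomp Require Import all_classical all_reals all_analysis.
From mathcomp Require Import ring lra.

Set Implicit Arguments.
Unset Strict Implicit.
Unset Printing Implicit Defensive.

Import Order.TTheory GRing.Theory Num.Theory.
Import numFieldNormedType.Exports.

Local Open Scope classical_set_scope.
Local Open Scope ring_scope.

(** Since [A] is conserved, [m^2 k r = l^2 - A . r] along the orbit, which is
therefore an arc of an ellipse in the plane orthogonal to [l]. In the orthogonal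
frame [A, l x A, l] the trace of a cone on this plane is a conic, and a conic
containing a nondegenerate arc of the ellipse is a multiple of it. Comparing
coefficients, the axis direction is [l + b A] or [l - b A] up to scaling
([b = |beta|]), and for each of these directions the vertex is one of two
points. The four resulting cones are distinct because a cone determines its
vertex. *)

(** An arc suffices. [A . r] is not constant along the orbit, so by the intermediate value theorem
    it fills an interval; over each of its values only some point of the orbit is known, which is
    why the second coordinate must be eliminated rather than prescribed.

    Excluding the circular energy amounts to [A <> 0], without which there is no frame. The
    definitions of epsilon and beta are used in root-free form, with [c = cos^2 (theta / 2)]: [eE]
    is the definition of beta cleared of denominators, and [bE], rewritten as
    [c (b^2 A^2 + l^2) = (m^2 k b)^2], makes the cone equation on the orbit plane exactly [b^2]
    times the ellipse equation.

    Four cones arise from two independent signs: [tau] chooses the axis direction and [s] the sign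
    of epsilon. *)

(** * Dot and cross products in coordinates, and the orthogonal frame *)

Section VectorAlgebra.
Context {R : realType}.
Implicit Types (u v w V Q : 'rV[R]_3) (a c : R).

Lemma dotvE u v :
  dotv u v = u 0 0 * v 0 0 + u 0 1 * v 0 1 + u 0 2%:R * v 0 2%:R.
Proof.
rewrite /dotv mxE !big_ord_recl big_ord0 addr0 !mxE addrA.
by congr (_ + u 0 _ * v 0 _ + u 0 _ * v 0 _); apply: val_inj.
Qed.

Lemma row3P u v :
  u 0 0 = v 0 0 -> u 0 1 = v 0 1 -> u 0 2%:R = v 0 2%:R -> u = v.
Proof.
move=> h0 h1 h2; apply/rowP => -[[|[|[|//]]] lti].
- by rewrite (_ : Ordinal lti = 0) //; apply: val_inj.
- by rewrite (_ : Ordinal lti = 1) //; apply: val_inj.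
- by rewrite (_ : Ordinal lti = 2%:R) //; apply: val_inj.
Qed.

Lemma crossvE u v :
  [/\ crossv u v 0 0 = u 0 1 * v 0 2%:R - u 0 2%:R * v 0 1,
      crossv u v 0 1 = u 0 2%:R * v 0 0 - u 0 0 * v 0 2%:R &
      crossv u v 0 2%:R = u 0 0 * v 0 1 - u 0 1 * v 0 0].
Proof.
by split; rewrite mxE; congr (u 0 _ * v 0 _ - u 0 _ * v 0 _); apply: val_inj.
Qed.

Lemma subZvE a u v i : (u - a *: v) 0 i = u 0 i - a * v 0 i.
Proof. by rewrite !mxE. Qed.

Lemma dotvC u v : dotv u v = dotv v u.
Proof. by rewrite !dotvE; ring. Qed.

Lemma dotvDl u v w : dotv (u + v) w = dotv u w + dotv v w.
Proof. by rewrite !dotvE !mxE; ring. Qed.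

Lemma dotvDr u v w : dotv u (v + w) = dotv u v + dotv u w.
Proof. by rewrite !dotvE !mxE; ring. Qed.

Lemma dotvZl a u v : dotv (a *: u) v = a * dotv u v.
Proof. by rewrite !dotvE !mxE; ring. Qed.

Lemma dotvZr a u v : dotv u (a *: v) = a * dotv u v.
Proof. by rewrite !dotvE !mxE; ring. Qed.

Lemma dotvNl u v : dotv (- u) v = - dotv u v.
Proof. by rewrite !dotvE !mxE; ring. Qed.

Lemma dotvNr u v : dotv u (- v) = - dotv u v.
Proof. by rewrite !dotvE !mxE; ring. Qed.

Lemma dotv0l u : dotv 0 u = 0.
Proof. by rewrite !dotvE !mxE; ring. Qed.

Definition dotv_lin := (dotvDl, dotvDr, dotvNl, dotvNr, dotvZl, dotvZr).

Lemma dotv_ge0 u : 0 <= dotv u u.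
Proof. by rewrite dotvE !addr_ge0 // -expr2 sqr_ge0. Qed.

Lemma dotv_eq0 u : (dotv u u == 0) = (u == 0).
Proof.
apply/idP/eqP => [|->]; last by rewrite dotv0l.
rewrite dotvE -!expr2 !paddr_eq0 ?addr_ge0 ?sqr_ge0 // !sqrf_eq0.
by move=> /andP[/andP[/eqP h0 /eqP h1] /eqP h2]; apply: row3P; rewrite mxE.
Qed.

Lemma dotv_gt0 u : u != 0 -> 0 < dotv u u.
Proof. by rewrite lt0r dotv_eq0 dotv_ge0 andbT. Qed.

Lemma sqr_enorm u : enorm u ^+ 2 = dotv u u.
Proof. by rewrite /enorm sqr_sqrtr ?dotv_ge0. Qed.

Lemma enorm_gt0 u : u != 0 -> 0 < enorm u.
Proof. by move=> /dotv_gt0; rewrite /enorm sqrtr_gt0. Qed.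

Lemma dotv_crossl u v : dotv (crossv u v) u = 0.
Proof. by have [e0 e1 e2] := crossvE u v; rewrite dotvE e0 e1 e2; ring. Qed.

Lemma dotv_crossr u v : dotv (crossv u v) v = 0.
Proof. by have [e0 e1 e2] := crossvE u v; rewrite dotvE e0 e1 e2; ring. Qed.

Lemma lagrange_identity u v :
  dotv (crossv u v) (crossv u v) = dotv u u * dotv v v - dotv u v ^+ 2.
Proof. by have [e0 e1 e2] := crossvE u v; rewrite !dotvE e0 e1 e2; ring. Qed.

Lemma cauchy_schwarz u v : dotv u v ^+ 2 <= dotv u u * dotv v v.
Proof. by rewrite -subr_ge0 -lagrange_identity dotv_ge0. Qed.

Lemma dotv_crossC u v w : dotv (crossv u v) w = dotv (crossv v w) u.
Proof.
have [e0 e1 e2] := crossvE u v; have [f0 f1 f2] := crossvE v w.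
by rewrite !dotvE e0 e1 e2 f0 f1 f2; ring.
Qed.

Lemma frame_decomp u v w : dotv u v = 0 -> u != 0 -> v != 0 ->
  exists a b c, w = a *: v + b *: crossv u v + c *: u.
Proof.
move=> uv0 un0 vn0; have := dotv_gt0 un0; have := dotv_gt0 vn0 => v0 u0.
exists (dotv w v / dotv v v), (dotv w (crossv u v) / (dotv u u * dotv v v)),
  (dotv w u / dotv u u).
have D0 : dotv u u * dotv v v != 0 by rewrite mulf_neq0 ?gt_eqF.
apply: (scalerI D0).
rewrite !scalerDr !scalerA.
rewrite (_ : _ * (dotv w v / _) = dotv u u * dotv w v); last first.
  by field; rewrite gt_eqF.
rewrite (_ : _ * (dotv w u / _) = dotv v v * dotv w u); last first.
  by field; rewrite gt_eqF.
rewrite (_ : _ * (_ / (_ * _)) = dotv w (crossv u v)); last first.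
  by field; rewrite !gt_eqF.
have [e0 e1 e2] := crossvE u v.
(* Cramer's rule for the Gram matrix of [u] and [v]: a polynomial identity that holds without
   orthogonality, so [ring] settles it in each coordinate. *)
have E i : (dotv u u * dotv v v - dotv u v ^+ 2) * w 0 i =
    (dotv u u * dotv w v - dotv w u * dotv u v) * v 0 i +
    dotv w (crossv u v) * crossv u v 0 i +
    (dotv v v * dotv w u - dotv w v * dotv u v) * u 0 i.
  case: i => -[|[|[|//]]] lti; rewrite !dotvE.
  - rewrite (_ : Ordinal lti = 0) ?e0 ?e1 ?e2; first by ring.
    exact: val_inj.
  - rewrite (_ : Ordinal lti = 1) ?e0 ?e1 ?e2; first by ring.
    exact: val_inj.
  - rewrite (_ : Ordinal lti = 2%:R) ?e0 ?e1 ?e2; first by ring.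
    exact: val_inj.
apply/rowP => i; rewrite !mxE -/(crossv u v); have := E i.
by rewrite uv0 !mulr0 expr0n /= !subr0 !mxE.
Qed.

End VectorAlgebra.

(** * Conservation of the angular momentum and of the Laplace-Runge-Lenz vector *)

(* The velocity is kept abstract: otherwise unification keeps unfolding
   [derive1]. *)
Section KeplerConservation.
Context {R : realType} {m k : R} {x v : R -> 'rV[R]_3}.
Implicit Types (s t : R) (i j n : 'I_3).
Hypothesis x0 : forall t, x t != 0.
Hypothesis dx : forall i t, is_derive t 1 (fun s => x s 0 i) (v t 0 i).
Hypothesis dv : forall i t,
  is_derive t 1 (fun s => v s 0 i) (- (k / enorm (x t) ^+ 3) * x t 0 i).

Lemma is_derive_enorm t :
  is_derive t 1 (fun s => enorm (x s)) (dotv (x t) (v t) / enorm (x t)).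
Proof.
have d0 := dx 0 t; have d1 := dx 1 t; have d2 := dx 2%:R t.
pose f s := x s 0 0 * x s 0 0 + x s 0 1 * x s 0 1 + x s 0 2%:R * x s 0 2%:R.
have df : is_derive t 1 f (2 * dotv (x t) (v t)).
  by apply: is_derive_eq; rewrite /GRing.scale /= dotvE; ring.
have f0 : 0 < f t by rewrite /f -dotvE dotv_gt0.
have dsq := is_derive1_sqrt f0.
rewrite (_ : (fun s => _) = Num.sqrt \o f); last first.
  by apply/funext => s; rewrite /enorm dotvE.
have dsf := @is_derive1_comp _ Num.sqrt f t _ _ dsq df.
apply: (is_derive_eq dsf); rewrite /GRing.scale /=.
rewrite /enorm (dotvE (x t) (x t)) -/(f t).
by field; rewrite gt_eqF ?sqrtr_gt0.
Qed.

Lemma cross_const s t : crossv (x s) (m *: v s) = crossv (x t) (m *: v t).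
Proof.
have E i j : x s 0 i * (m *: v s) 0 j - x s 0 j * (m *: v s) 0 i =
    x t 0 i * (m *: v t) 0 j - x t 0 j * (m *: v t) 0 i.
  pose f s := x s 0 i * (m * v s 0 j) - x s 0 j * (m * v s 0 i).
  suff : f s = f t by rewrite /f !mxE.
  apply: is_derive_0_is_cst => {s}t'.
  have xi := dx i t'; have xj := dx j t'.
  have vi := dv i t'; have vj := dv j t'.
  by apply: is_derive_eq; rewrite /GRing.scale /=; ring.
by apply/rowP => i; rewrite mxE E [RHS]mxE.
Qed.

(** One differentiation serves all three components: [(i, j, n)] ranges over the cyclic permutations
    of the indices, and [c] is the angular momentum. *)
Lemma lrl_component_const i j n (c : R -> 'rV[R]_3) s t :
  (forall u w : 'rV[R]_3,
    dotv u w = u 0 i * w 0 i + u 0 j * w 0 j + u 0 n * w 0 n) ->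
  (forall t', c t' 0 n = x t' 0 i * (m *: v t') 0 j
                         - x t' 0 j * (m *: v t') 0 i) ->
  (forall t', c t' 0 j = x t' 0 n * (m *: v t') 0 i
                         - x t' 0 i * (m *: v t') 0 n) ->
  (forall t' t'', c t' = c t'') ->
  let f s := (m *: v s) 0 j * c s 0 n - (m *: v s) 0 n * c s 0 j
             - m ^+ 2 * k / enorm (x s) * x s 0 i in
  f s = f t.
Proof.
move=> dE cn cj cC f.
suff : forall t', is_derive t' 1 f 0 by move=> df; apply: is_derive_0_is_cst.
move=> t'.
(* Since [c] is conserved it can be frozen at [t'], so that only the velocity and the position get
   differentiated. *)
have -> : f = fun s => m * v s 0 j * c t' 0 n - m * v s 0 n * c t' 0 j
    - m ^+ 2 * k * (enorm (x s))^-1 * x s 0 i.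
  by apply/funext => s'; rewrite /f (cC s' t') !mxE.
have xi := dx i t'; have vj := dv j t'; have vn := dv n t'.
have de := is_derive_enorm t'.
have e0 : enorm (x t') != 0 by rewrite gt_eqF ?enorm_gt0.
have dV := @is_deriveV _ (fun s => enorm (x s)) t' _ _ e0 de.
apply: is_derive_eq; rewrite /GRing.scale /= cn cj !mxE.
have := sqr_enorm (x t'); rewrite !dE.
move: (enorm _) e0 => e e0 eE.
(* The derivative is a multiple of [x . x - e^2], which vanishes as [e] is the norm of [x]. *)
transitivity (m ^+ 2 * k / e ^+ 3 * v t' 0 i *
  (x t' 0 i * x t' 0 i + x t' 0 j * x t' 0 j + x t' 0 n * x t' 0 n - e ^+ 2)).
  by field.
by rewrite eE subrr mulr0.
Qed.

Lemma lrl_const s t :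
  let A t := crossv (m *: v t) (crossv (x t) (m *: v t))
             - (m ^+ 2 * k / enorm (x t)) *: x t in
  A s = A t.
Proof.
have lE t' := crossvE (x t') (m *: v t').
have AE t' := crossvE (m *: v t') (crossv (x t') (m *: v t')).
have dE1 (u w : 'rV[R]_3) :
    dotv u w = u 0 1 * w 0 1 + u 0 2%:R * w 0 2%:R + u 0 0 * w 0 0.
  by rewrite dotvE; ring.
have dE2 (u w : 'rV[R]_3) :
    dotv u w = u 0 2%:R * w 0 2%:R + u 0 0 * w 0 0 + u 0 1 * w 0 1.
  by rewrite dotvE; ring.
pose c t := crossv (x t) (m *: v t).
have cC t' t'' : c t' = c t'' by apply: cross_const.
have [e0 e1 e2] := AE s; have [f0 f1 f2] := AE t.
apply: row3P; rewrite !subZvE ?e0 ?e1 ?e2 ?f0 ?f1 ?f2 -/(c s) -/(c t).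
- apply: (lrl_component_const s t dotvE _ _ cC) => t'; have [_ g1 g2] := lE t'.
  + exact: g2.
  + exact: g1.
- apply: (lrl_component_const s t dE1 _ _ cC) => t'; have [g0 _ g2] := lE t'.
  + exact: g0.
  + exact: g2.
- apply: (lrl_component_const s t dE2 _ _ cC) => t'; have [g0 g1 _] := lE t'.
  + exact: g1.
  + exact: g0.
Qed.

End KeplerConservation.

Section Kepler.
Context {R : realType} {m k : R} {r : R -> 'rV[R]_3}.
Implicit Types (s t : R).
Hypothesis rK : kepler_solution k r.

Lemma kepler_neq0 t : r t != 0. Proof. by case: (rK t). Qed.

Lemma is_derive_position i t :
  is_derive t 1 (fun s => r s 0 i) (derive1 r t 0 i).
Proof.
have [_ dr _ _] := rK t; have /derivable_mxP dri := dr.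
by rewrite derive1E derive_mx // mxE; apply: DeriveDef => //; apply: dri.
Qed.

Lemma is_derive_velocity i t :
  is_derive t 1 (fun s => derive1 r s 0 i) (- (k / enorm (r t) ^+ 3) * r t 0 i).
Proof.
have [_ _ dr E] := rK t; have /derivable_mxP dri := dr.
have := congr1 (fun M : 'rV[R]_3 => M 0 i) E.
rewrite [RHS]mxE => <-; rewrite derive1E derive_mx // mxE.
by apply: DeriveDef => //; apply: dri.
Qed.

Lemma angular_momentum_const s t :
  angular_momentum m r s = angular_momentum m r t.
Proof. exact: cross_const is_derive_position is_derive_velocity s t. Qed.

Lemma lrl_vector_const s t : lrl_vector m k r s = lrl_vector m k r t.
Proof.
exact: lrl_const kepler_neq0 is_derive_position is_derive_velocity s t.
Qed.

End Kepler.

Lemma crossv_crossv {R : realType} (u v w : 'rV[R]_3) :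
  crossv u (crossv v w) = dotv u w *: v - dotv u v *: w.
Proof.
have [e0 e1 e2] := crossvE u (crossv v w); have [f0 f1 f2] := crossvE v w.
by apply: row3P; rewrite ?e0 ?e1 ?e2 ?f0 ?f1 ?f2 !dotvE !mxE; ring.
Qed.

(** * The orbit plane, the focal equation of the orbit and the size of [A] *)

Section OrbitPlane.
Context {R : realType} {m k : R} {r : R -> 'rV[R]_3}.
Implicit Types (s t : R).
Hypothesis rK : kepler_solution k r.

Lemma dotv_position_angular_momentum t :
  dotv (r t) (angular_momentum m r t) = 0.
Proof. by rewrite dotvC dotv_crossl. Qed.

Lemma dotv_lrl_angular_momentum t :
  dotv (angular_momentum m r t) (lrl_vector m k r t) = 0.
Proof.
rewrite /lrl_vector !dotv_lin dotvC dotv_crossr sub0r.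
by rewrite dotvC dotv_position_angular_momentum mulr0 oppr0.
Qed.

Lemma dotv_crossv_position t :
  dotv (crossv (momentum m r t) (angular_momentum m r t)) (r t) =
  dotv (angular_momentum m r t) (angular_momentum m r t).
Proof. by rewrite dotv_crossC dotv_crossC. Qed.

Lemma dotv_lrl_position t :
  m ^+ 2 * k * enorm (r t) =
  dotv (angular_momentum m r t) (angular_momentum m r t)
  - dotv (lrl_vector m k r t) (r t).
Proof.
have r0 := enorm_gt0 (kepler_neq0 rK t).
rewrite /lrl_vector !dotv_lin dotv_crossv_position -(sqr_enorm (r t)).
by field; exact: lt0r_neq0.
Qed.

(** As [p] and [l] are orthogonal, Lagrange's identity gives [|p x l|^2 = p^2 l^2]. This relation is
    what identifies [A = 0] with the circular energy. *)
Lemma dotv_lrl_lrl t : 0 < m ->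
  let l := angular_momentum m r t in
  dotv (lrl_vector m k r t) (lrl_vector m k r t) =
  (m ^+ 2 * k) ^+ 2 + 2 * m * energy m k r t * dotv l l.
Proof.
move=> m0 l; have r0 := enorm_gt0 (kepler_neq0 rK t).
rewrite /lrl_vector /energy -/l !dotv_lin.
rewrite (dotvC (r t) (crossv _ _)) dotv_crossv_position lagrange_identity.
rewrite (dotvC _ l) dotv_crossr -/l sqr_enorm -(sqr_enorm (r t)).
by field; rewrite !lt0r_neq0.
Qed.

Lemma continuous_dotv_position u t :
  {for t, continuous (fun s => dotv u (r s))}.
Proof.
have d0 := is_derive_position rK 0 t; have d1 := is_derive_position rK 1 t.
have d2 := is_derive_position rK 2%:R t.
apply: differentiable_continuous; apply/derivable1_diffP.
rewrite (_ : (fun s => _) = fun s =>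
    u 0 0 * r s 0 0 + u 0 1 * r s 0 1 + u 0 2%:R * r s 0 2%:R); last first.
  by apply/funext => s; rewrite dotvE.
exact: ex_derive.
Qed.

(** If [A . r] were constant, differentiating once gives [A . v = 0], and once more [A . r = 0],
    because the acceleration is a nonzero multiple of [r]. Then [A x (r x p) = 0] by the triple
    product formula, which is impossible for nonzero orthogonal [A] and [l]. *)
Lemma lrl_position_nonconst t0 c : 0 < m -> k != 0 ->
  angular_momentum m r t0 != 0 -> lrl_vector m k r t0 != 0 ->
  ~ forall t, dotv (lrl_vector m k r t0) (r t) = c.
Proof.
move=> m0 k0 l0 A0 cE; set A := lrl_vector m k r t0 in A0 cE.
set v := derive1 r.
have dvE (g g' : R -> 'rV[R]_3) :
    (forall i t, is_derive t 1 (fun s => g s 0 i) (g' t 0 i)) ->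
    (forall s t, dotv A (g s) = dotv A (g t)) -> forall t, dotv A (g' t) = 0.
  move=> dg gc t; have d0 := dg 0 t; have d1 := dg 1 t.
  have d2 := dg 2%:R t.
  have H : is_derive t 1 (fun s =>
    A 0 0 * g s 0 0 + A 0 1 * g s 0 1 + A 0 2%:R * g s 0 2%:R) (dotv A (g' t)).
    by apply: is_derive_eq; rewrite /GRing.scale /= dotvE; ring.
  have H' : is_derive t 1 (fun _ : R => dotv A (g t)) (dotv A (g' t)).
    rewrite (_ : (fun _ : R => _) = fun s =>
      A 0 0 * g s 0 0 + A 0 1 * g s 0 1 + A 0 2%:R * g s 0 2%:R) //.
    by apply/funext => s; rewrite (gc t s) dotvE.
  by rewrite -(@derive_val _ _ _ _ _ _ _ H') derive_cst.
have Av : forall t, dotv A (v t) = 0.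
  by apply: (dvE r v (is_derive_position rK)) => s t; rewrite !cE.
have Ax t : dotv A (r t) = 0.
  have : dotv A (- (k / enorm (r t) ^+ 3) *: r t) = 0.
    apply: (dvE v (fun t => - (k / enorm (r t) ^+ 3) *: r t)) => [i s|s s'].
      by rewrite [X in is_derive _ _ _ X]mxE; apply: is_derive_velocity rK i s.
    by rewrite !Av.
  rewrite dotvZr => /eqP.
  rewrite mulf_eq0 oppr_eq0 mulf_eq0 (negPf k0) invr_eq0.
  by rewrite expf_eq0 /= gt_eqF ?enorm_gt0 ?(kepler_neq0 rK) //= => /eqP.
have : crossv A (angular_momentum m r t0) = 0.
  rewrite /angular_momentum /momentum crossv_crossv Ax dotvZr -/v Av mulr0.
  by rewrite !scale0r subr0.
move=> /(congr1 (fun u => dotv u u)).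
rewrite dotv0l lagrange_identity dotvC dotv_lrl_angular_momentum expr0n subr0.
by move/eqP; rewrite mulf_eq0 !dotv_eq0 (negPf l0) (negPf A0).
Qed.

End OrbitPlane.

(** * Conics vanishing on an arc of an ellipse *)

Lemma quartic_vanish {R : realType} (p q c0 c1 c2 c3 c4 : R) : p < q ->
  (forall x, p <= x <= q ->
    c0 + c1 * x + c2 * x ^+ 2 + c3 * x ^+ 3 + c4 * x ^+ 4 = 0) ->
  [/\ c0 = 0, c1 = 0, c2 = 0, c3 = 0 & c4 = 0].
Proof.
move=> pq c_vanish; pose P : {poly R} := Poly [:: c0; c1; c2; c3; c4].
(* Five equally spaced points of the interval, one more than the degree allows as roots. *)
pose x (i : nat) := p + i%:R / 4 * (q - p).
have P0 : P = 0.
  apply: (@roots_geq_poly_eq0 _ _ [seq x i | i <- iota 0 5]).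
  - apply/allP => _ /mapP[i i5 ->].
    apply/rootP; rewrite horner_Poly /= -[RHS](c_vanish (x i)).
      by move: (x i) => y; ring.
    have i4 : (i%:R : R) <= 4 by rewrite ler_nat; move: i5; rewrite mem_iota.
    have i0 : 0 <= (i%:R : R) by rewrite ler0n.
    by rewrite /x; apply/andP; split; nra.
  - rewrite map_inj_uniq ?iota_uniq // => i j /addrI xij.
    apply/eqP; rewrite -(eqr_nat R); apply/eqP.
    have qp : q - p != 0 by rewrite subr_eq0 gt_eqF.
    move: xij => /(mulIf qp) xij.
    have four : (4 : R)^-1 != 0 by rewrite invr_eq0 pnatr_eq0.
    exact: mulIf four _ _ xij.
  - exact: leq_trans (size_Poly _) _.
have cE i : (Poly [:: c0; c1; c2; c3; c4])`_i = 0 by rewrite -/P P0 coef0.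
by split; [move: (cE 0%N)|move: (cE 1%N)|move: (cE 2%N)|move: (cE 3%N)
  |move: (cE 4%N)]; rewrite coef_Poly.
Qed.

(* On the ellipse [S] every quadratic equation reads
   [c2 x^2 + c1 x + c0 = - y (d1 x + d0)]. Squaring and eliminating [y^2] gives
   a quartic in [x], whose coefficients have the form of a square plus a
   nonnegative term because [q2 < 0]. *)
Lemma conic_vanish {R : realType} (S : R -> R -> Prop)
    (p q q2 q1 q0 c2 c1 c0 d1 d0 : R) :
  p < q -> (forall x, p <= x <= q -> exists y, S x y) -> q2 < 0 ->
  (forall x y, S x y -> y ^+ 2 = q2 * x ^+ 2 + q1 * x + q0) ->
  (forall x y, S x y ->
    c2 * x ^+ 2 + c1 * x + c0 + y * (d1 * x + d0) = 0) ->
  [/\ c2 = 0, c1 = 0, c0 = 0, d1 = 0 & d0 = 0].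
Proof.
move=> pq Sx q2_lt0 yE c_vanish.
have [] := @quartic_vanish _ p q (c0 ^+ 2 - q0 * d0 ^+ 2)
  (2 * c1 * c0 - q1 * d0 ^+ 2 - 2 * q0 * d1 * d0)
  (c1 ^+ 2 + 2 * c2 * c0 - q2 * d0 ^+ 2 - 2 * q1 * d1 * d0 - q0 * d1 ^+ 2)
  (2 * c2 * c1 - 2 * q2 * d1 * d0 - q1 * d1 ^+ 2)
  (c2 ^+ 2 - q2 * d1 ^+ 2) pq.
  move=> x /Sx[y Sxy]; have y2 := yE _ _ Sxy.
  have /eqP := c_vanish _ _ Sxy; rewrite addr_eq0 => /eqP E.
  transitivity ((c2 * x ^+ 2 + c1 * x + c0) ^+ 2
    - (q2 * x ^+ 2 + q1 * x + q0) * (d1 * x + d0) ^+ 2); first by ring.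
  by rewrite E -y2; ring.
have sum_sqr u v : u ^+ 2 - q2 * v ^+ 2 = 0 -> u = 0 /\ v = 0.
  have nq2 : 0 <= - q2 by rewrite oppr_ge0 ltW.
  have v2 : 0 <= - q2 * v ^+ 2 by rewrite mulr_ge0 ?sqr_ge0.
  move=> /eqP; rewrite -mulNr paddr_eq0 ?sqr_ge0 //.
  rewrite sqrf_eq0 mulf_eq0 oppr_eq0 sqrf_eq0 (lt_eqF q2_lt0) /=.
  by move=> /andP[/eqP -> /eqP ->].
(* The leading coefficient kills [c2] and [d1]; the quadratic one then takes the same shape in [c1]
   and [d0], and the constant one leaves [c0 ^+ 2]. *)
move=> E0 _ E2 _ /sum_sqr[c20 d10]; subst c2 d1.
have [|c10 d00] := sum_sqr c1 d0; first by rewrite -E2; ring.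
subst c1 d0; split => //.
by apply/eqP; rewrite -sqrf_eq0; apply/eqP; rewrite -E0; ring.
Qed.

(** * Cones in frame coordinates: [M = m^2 k], [L = l^2], [a = A^2], [H = 2 m h],
    [c = cos^2 (theta / 2)], [b = |beta|], [e = |epsilon|] *)

Section ConeEquation.
Context {R : realType}.
Variables (M L a H c b e : R).
Hypotheses (M0 : 0 < M) (L0 : 0 < L) (a0 : 0 < a) (H0 : H < 0) (c0 : 0 < c)
  (b0 : 0 < b).
Hypothesis aE : a = M ^+ 2 + H * L.
Hypothesis bE : c * L = b ^+ 2 * (M ^+ 2 - c * a).
Hypothesis eE : e ^+ 2 * (1 + H * b ^+ 2) = b ^+ 2.

(** The square of the focal equation [M |r| = L - A . r] at [r = x A + y W]. *)
Definition ellipse (x y : R) : Prop :=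
  M ^+ 2 * (a * x ^+ 2 + L * a * y ^+ 2) = (L - a * x) ^+ 2.

(* The cone with vertex [v1 A + v2 W + v3 l] and direction [u1 A + u2 W + u3 l]
   at the point [x A + y W] of the orbit plane, in the orthogonal frame
   [A, W = l x A, l] with squared lengths [a, L a, L]. *)
Definition cone_poly (u1 u2 u3 v1 v2 v3 x y : R) : R :=
  (a * (x - v1) * u1 + L * a * (y - v2) * u2 - L * v3 * u3) ^+ 2
  - c * (a * u1 ^+ 2 + L * a * u2 ^+ 2 + L * u3 ^+ 2) *
    (a * (x - v1) ^+ 2 + L * a * (y - v2) ^+ 2 + L * v3 ^+ 2).

(** The [A]-coordinate of the vertex: for [s = 1] and [s = -1], the two roots [g] of
    [(b (1 - H g))^2 = e^2]. *)
Definition vertex_coord (s : R) := (1 + s * e / b) / H.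

Lemma vertex_coordE s : s ^+ 2 = 1 ->
  2 * vertex_coord s - H * vertex_coord s ^+ 2 = e ^+ 2.
Proof.
move=> s2; rewrite /vertex_coord.
have H0' := ltr0_neq0 H0; have b0' := lt0r_neq0 b0.
transitivity ((1 - s ^+ 2 * e ^+ 2 / b ^+ 2) / H).
  by field; rewrite H0' b0'.
apply: (mulIf H0'); rewrite s2 divfK //.
have b2 : b ^+ 2 != 0 by rewrite expf_neq0.
by apply: (mulIf b2); rewrite mulrBl mul1r mul1r divfK // -{1}eE; ring.
Qed.

(** For this axis and vertex the cone polynomial is [b^2] times the difference of the two sides of
    the ellipse equation. *)
Lemma cone_poly_ellipse (s tau x y : R) : s ^+ 2 = 1 -> tau ^+ 2 = 1 ->
  ellipse x y ->
  cone_poly (tau * b) 0 1 (vertex_coord s) 0 (- (tau * (s * e))) x y = 0.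
Proof.
move=> s2 t2 xy; have gE := vertex_coordE s2.
have gH : H * vertex_coord s = 1 + s * e / b.
  by rewrite /vertex_coord mulrC divfK // ltr0_neq0.
have {}gH : b * H * vertex_coord s = b + s * e.
  by rewrite -mulrA gH; field; rewrite lt0r_neq0.
move: (vertex_coord s) gE gH => g gE gH.
have KE : c * (a * b ^+ 2 + L) = M ^+ 2 * b ^+ 2.
  by rewrite mulrDr bE; ring.
rewrite /cone_poly.
transitivity (tau ^+ 2 * (a * b * (x - g) + L * (s * e)) ^+ 2
  - c * (tau ^+ 2 * a * b ^+ 2 + L) *
    (a * (x - g) ^+ 2 + L * a * y ^+ 2 + tau ^+ 2 * s ^+ 2 * L * e ^+ 2)).
  by ring.
rewrite t2 s2 !mul1r KE.
have -> : s * e = b * H * g - b by rewrite gH; ring.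
rewrite -gE.
transitivity (b ^+ 2 * ((L - a * x) ^+ 2
   - M ^+ 2 * (a * x ^+ 2 + L * a * y ^+ 2))); last first.
  by rewrite xy; ring.
by rewrite aE; ring.
Qed.

(** The five vanishing coefficients suffice: [x y] forces [u2 = 0], [x^2] fixes [u1 / u3] up to
    sign, [y] forces [v2 = 0], and the two remaining ones determine [v3] from [v1] and a quadratic
    equation for [v1]. *)
Lemma orbit_cone_coord (S : R -> R -> Prop) (p q u1 u2 u3 v1 v2 v3 : R) :
  p < q -> (forall x, p <= x <= q -> exists y, S x y) ->
  (forall x y, S x y -> ellipse x y) ->
  (u1, u2, u3) <> (0, 0, 0) ->
  (forall x y, S x y -> cone_poly u1 u2 u3 v1 v2 v3 x y = 0) ->
  exists s tau : bool, 
    [/\ u3 != 0, u1 = (-1) ^+ tau * b * u3 & u2 = 0] /\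
    [/\ v1 = vertex_coord ((-1) ^+ s), v2 = 0 &
        v3 = - ((-1) ^+ tau * ((-1) ^+ s * e))].
Proof.
move=> pq Sx S_ellipse u0 S_cone.
have [K Kdef] : exists K, c * (a * u1 ^+ 2 + L * a * u2 ^+ 2 + L * u3 ^+ 2) = K.
  by eexists.
have K0 : 0 < K.
  rewrite -Kdef.
  have h1 : 0 <= a * u1 ^+ 2 by rewrite mulr_ge0 ?sqr_ge0 // ltW.
  have h2 : 0 <= L * a * u2 ^+ 2.
    by rewrite mulr_ge0 ?sqr_ge0 // ltW // mulr_gt0.
  have h3 : 0 <= L * u3 ^+ 2 by rewrite mulr_ge0 ?sqr_ge0 // ltW.
  rewrite mulr_gt0 // lt0r !addr_ge0 // andbT; apply/negP.
  rewrite !paddr_eq0 ?addr_ge0 // => /andP[/andP[]].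
  rewrite !mulf_eq0 (gt_eqF a0) (gt_eqF L0) /= !orbb.
  by move=> /eqP h4 /eqP h5 /eqP h6; apply: u0; rewrite h4 h5 h6.
pose w := a * v1 * u1 + L * a * v2 * u2 + L * v3 * u3.
have MLa0 : M ^+ 2 * (L * a) != 0 by rewrite !mulf_neq0 ?expf_neq0 ?lt0r_neq0.
have aM : a - M ^+ 2 < 0 by rewrite aE addrAC subrr add0r nmulr_rlt0.
have q20 : (a ^+ 2 - M ^+ 2 * a) / (M ^+ 2 * (L * a)) < 0.
  rewrite expr2 -mulrBl mulrC pmulr_rlt0 ?invr_gt0 ?mulr_gt0 ?exprn_gt0 //.
  by rewrite mulrC pmulr_rlt0.
(* The cone equation times [M^2], with [y^2] eliminated by [M^2 L a y^2 = (a^2 - M^2 a) x^2 - 2 L a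
   x + L^2]. *)
have [||] := @conic_vanish _ S p q _
  (- (2 * L * a) / (M ^+ 2 * (L * a))) (L ^+ 2 / (M ^+ 2 * (L * a)))
  (M ^+ 2 * (a ^+ 2 * u1 ^+ 2 - K * a)
    + (L * a * u2 ^+ 2 - K) * (a ^+ 2 - M ^+ 2 * a))
  (M ^+ 2 * (2 * K * a * v1 - 2 * a * u1 * w)
    - (L * a * u2 ^+ 2 - K) * (2 * L * a))
  (M ^+ 2 * (w ^+ 2 - K * (a * v1 ^+ 2 + L * a * v2 ^+ 2 + L * v3 ^+ 2))
    + (L * a * u2 ^+ 2 - K) * L ^+ 2)
  (M ^+ 2 * (2 * L * a ^+ 2 * u1 * u2))
  (M ^+ 2 * (2 * K * L * a * v2 - 2 * L * a * u2 * w)) pq Sx q20.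
- move=> x y /S_ellipse xy.
  apply: (mulfI MLa0).
  transitivity ((L - a * x) ^+ 2 - M ^+ 2 * a * x ^+ 2).
    by rewrite -xy; ring.
  by field; rewrite !lt0r_neq0.
- move=> x y Sxy; have xy := S_ellipse _ _ Sxy; have := S_cone _ _ Sxy.
  move=> /(congr1 (fun z => M ^+ 2 * z)); rewrite mulr0 => <-.
  rewrite /cone_poly Kdef.
  apply/eqP; rewrite -subr_eq0; apply/eqP.
  transitivity ((L * a * u2 ^+ 2 - K) * ((L - a * x) ^+ 2
    - M ^+ 2 * (a * x ^+ 2 + L * a * y ^+ 2))); first by rewrite /w; ring.
  by rewrite xy subrr mulr0.
move=> E2 E1 E0 F1 F0.
have a0' := lt0r_neq0 a0; have L0' := lt0r_neq0 L0; have M0' := lt0r_neq0 M0.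
have H0' := ltr0_neq0 H0; have b0' := lt0r_neq0 b0.
(* If [u1] vanished, the [x^2] coefficient would say [K = L u2^2 (a - M^2)], against [K > 0] and
   [a < M^2]; the latter comes from the negative energy. *)
have u20 : u2 = 0.
  have u12 : u1 * u2 = 0.
    have : 2 * M ^+ 2 * L * a ^+ 2 != 0.
      by rewrite !mulf_neq0 ?expf_neq0 ?pnatr_eq0.
    by move=> /mulfI; apply; rewrite mulr0 -[RHS]F1; ring.
  move/eqP: u12; rewrite mulf_eq0 => /orP[/eqP u10|/eqP//].
  have : a ^+ 2 * (L * u2 ^+ 2 * (a - M ^+ 2) - K) = 0.
    by rewrite -[RHS]E2 u10; ring.
  move=> /eqP; rewrite mulf_eq0 (negPf (expf_neq0 2 a0')) /= subr_eq0 => /eqP E.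
  have : L * u2 ^+ 2 * (a - M ^+ 2) <= 0.
    have h2 : 0 <= L * u2 ^+ 2 by rewrite mulr_ge0 ?sqr_ge0 // ltW.
    by rewrite mulr_ge0_le0 // ltW.
  by rewrite E leNgt K0.
have KE : K = M ^+ 2 * u1 ^+ 2.
  apply: (mulfI (expf_neq0 2 a0')); apply/eqP; rewrite -subr_eq0; apply/eqP.
  by rewrite -[RHS]oppr0 -[in RHS]E2 u20; ring.
have u10 : u1 != 0.
  by apply/negP => /eqP u10; move: K0; rewrite KE u10 expr0n mulr0 ltxx.
have u1E : u1 ^+ 2 = (b * u3) ^+ 2.
  have D0 : M ^+ 2 - c * a != 0.
    apply/negP => /eqP D0; move/eqP: bE; rewrite D0 mulr0 mulf_eq0.
    by rewrite (negPf L0') gt_eqF.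
  apply: (mulfI D0).
  transitivity (c * L * u3 ^+ 2); last by rewrite bE; ring.
  transitivity (K - c * a * u1 ^+ 2); first by rewrite KE; ring.
  by rewrite -Kdef u20; ring.
have u30 : u3 != 0.
  apply/negP => /eqP u30; move/eqP: u1E; rewrite u30 mulr0 expr0n sqrf_eq0.
  by rewrite (negPf u10).
have [tau u1E'] : exists tau : bool, u1 = (-1) ^+ tau * b * u3.
  move/eqP: u1E; rewrite eqf_sqr => /orP[]/eqP ->.
    by exists false; rewrite mul1r.
  by exists true; rewrite expr1 mulN1r mulNr.
have v20 : v2 = 0.
  have D0 : M ^+ 2 * (2 * K * L * a) != 0.
    by rewrite !mulf_neq0 ?expf_neq0 ?pnatr_eq0 ?(lt0r_neq0 K0).
  by apply: (mulfI D0); rewrite mulr0 -[RHS]F0 u20; ring.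
have wE : w = u1 * (L + M ^+ 2 * v1).
  have D0 : 2 * a * M ^+ 2 * u1 != 0.
    by rewrite !mulf_neq0 ?expf_neq0 ?pnatr_eq0.
  apply: (mulfI D0); apply/eqP; rewrite -subr_eq0; apply/eqP.
  by rewrite -[RHS]oppr0 -[in RHS]E1 u20 KE; ring.
set tb := (-1) ^+ tau in u1E' *.
have tb2 : tb ^+ 2 = 1 by rewrite sqrr_sign.
have v3E : v3 = tb * (b * (1 - H * v1)).
  apply: (mulfI u30); apply: (mulfI L0').
  transitivity (w - a * v1 * u1); first by rewrite /w u20; ring.
  by rewrite wE aE u1E'; ring.
have v3E2 : v3 ^+ 2 = 2 * v1 - H * v1 ^+ 2.
  have D0 : M ^+ 2 * u1 ^+ 2 * M ^+ 2 * L != 0 by rewrite !mulf_neq0 ?expf_neq0.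
  apply: (mulfI D0); apply/eqP; rewrite -subr_eq0; apply/eqP.
  by rewrite -[RHS]oppr0 -[in RHS]E0 u20 v20 KE wE [in RHS]aE; ring.
(* With [z = 1 - H v1], the two expressions for [v3^2] give [H b^2 z^2 = 1 - z^2], and [eE] turns
   this into [(b z)^2 = e^2]. *)
have : (b * (1 - H * v1)) ^+ 2 = e ^+ 2.
  have z2 : (1 - H * v1) ^+ 2 * (1 + H * b ^+ 2) = 1.
    transitivity ((1 - H * v1) ^+ 2 + H * (tb ^+ 2 * (b * (1 - H * v1)) ^+ 2)).
      by rewrite tb2; ring.
    by rewrite -exprMn -v3E v3E2; ring.
  transitivity (e ^+ 2 * ((1 - H * v1) ^+ 2 * (1 + H * b ^+ 2))).
    by rewrite exprMn -{1}eE; ring.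
  by rewrite z2 mulr1.
move=> /eqP; rewrite eqf_sqr => zE.
have [s sE] : exists s : bool, b * (1 - H * v1) = - ((-1) ^+ s * e).
  case/orP: zE => /eqP ->; first by exists true; rewrite expr1 mulN1r opprK.
  by exists false; rewrite mul1r.
exists s, tau; split; split => //.
  rewrite /vertex_coord; apply: (mulIf H0'); rewrite divfK //.
  apply: (mulIf b0'); rewrite mulrDl divfK //.
  by apply/eqP; rewrite -subr_eq0 -[_ * e]opprK -sE; apply/eqP; ring.
by rewrite v3E sE mulrN.
Qed.

End ConeEquation.

(** * Polynomial equation of a cone, and uniqueness of its vertex *)

Section Cones.
Context {R : realType} {theta : R}.
Implicit Types (V u Q g : 'rV[R]_3).
Hypothesis theta_bd : 0 < theta < pi.

Lemma half_bloom_bounds : 0 < theta / 2 < pi / 2.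
Proof. by case/andP: theta_bd => t0 tpi; apply/andP; split; lra. Qed.

Lemma cos_half_bloom_gt0 : 0 < cos (theta / 2).
Proof.
apply: cos_gt0_pihalf; case/andP: half_bloom_bounds => t0 tpi.
by apply/andP; split => //; have := pi_gt0 R; lra.
Qed.

Lemma sin_half_bloom_gt0 : 0 < sin (theta / 2).
Proof.
apply: sin_gt0_pi; case/andP: half_bloom_bounds => t0 tpi.
by apply/andP; split => //; have := pi_gt0 R; lra.
Qed.

(** Squaring loses nothing because both cosines are nonnegative, and Cauchy-Schwarz keeps the
    quotient in the domain where [acos] inverts [cos]. At the vertex both sides are 0. *)
Lemma mem_cone V u Q : u != 0 -> cone V u theta Q <->
  dotv (Q - V) u ^+ 2 =
  cos (theta / 2) ^+ 2 * dotv u u * dotv (Q - V) (Q - V).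
Proof.
move=> u0; have [->|QV] := eqVneq Q V.
  by split=> _; [rewrite subrr !dotv0l expr0n mulr0|left].
have d0 : Q - V != 0 by rewrite subr_eq0.
rewrite /cone /line_angle /=; move: (Q - V) d0 => d d0.
have nd0 := enorm_gt0 d0; have nu0 := enorm_gt0 u0.
set x := `|dotv d u| / (enorm d * enorm u).
have x0 : 0 <= x by rewrite divr_ge0 // ltW // mulr_gt0.
have x2 : x ^+ 2 = dotv d u ^+ 2 / (dotv u u * dotv d d).
  rewrite /x expr_div_n real_normK ?num_real // exprMn !sqr_enorm.
  by rewrite [X in _ / X]mulrC.
have D0 : 0 < dotv u u * dotv d d by rewrite mulr_gt0 ?dotv_gt0.
have x1 : x <= 1.
  rewrite -(@ler_pXn2r _ 2) ?nnegrE // expr1n x2 ler_pdivrMr // mul1r.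
  by rewrite mulrC cauchy_schwarz.
have c0 := cos_half_bloom_gt0.
have xE : (acos x = theta / 2) <-> (x = cos (theta / 2)).
  split=> [<-|->]; first by rewrite acosK // in_itv /= x1 andbT; lra.
  rewrite cosK // in_itv /=; case/andP: half_bloom_bounds => t0 tpi.
  by apply/andP; split; have := pi_gt0 R; lra.
have sE : (x = cos (theta / 2)) <-> (dotv d u ^+ 2 =
    cos (theta / 2) ^+ 2 * dotv u u * dotv d d).
  split=> [xc|E].
    by rewrite -mulrA -xc x2 divfK // gt_eqF.
  apply/eqP; rewrite -(@eqrXn2 _ 2) // ?ltW // x2 E.
  by rewrite -[_ * _ * dotv d d]mulrA mulfK // gt_eqF.
split=> [[/eqP|[_ /xE/sE//]]|/sE/xE E]; last by right; split => //; apply/eqP.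
by rewrite (negPf QV).
Qed.

Lemma mem_cone_addr V u g : u != 0 -> cone V u theta (V + g) <->
  dotv g u ^+ 2 = cos (theta / 2) ^+ 2 * dotv u u * dotv g g.
Proof. by move=> u0; rewrite mem_cone // addrAC subrr add0r. Qed.

Lemma coneN V u g : u != 0 -> cone V u theta (V + g) -> cone V u theta (V - g).
Proof.
move=> u0; rewrite !mem_cone_addr // => E.
by rewrite !dotvNl !dotvNr opprK sqrrN.
Qed.

Lemma coneZ V u q : u != 0 -> q != 0 -> cone V (q *: u) theta = cone V u theta.
Proof.
move=> u0 q0; have qu0 : q *: u != 0 by rewrite scaler_eq0 negb_or q0.
have q20 : q ^+ 2 != 0 by rewrite expf_neq0.
apply/funext => Q; apply/propext; rewrite !mem_cone // !dotvZr !dotvZl exprMn.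
have -> : cos (theta / 2) ^+ 2 * (q * (q * dotv u u)) *
    dotv (Q - V) (Q - V) =
  q ^+ 2 * (cos (theta / 2) ^+ 2 * dotv u u * dotv (Q - V) (Q - V)).
  by ring.
by split=> [/(mulfI q20)|->].
Qed.

(* The cone is invariant under the point reflections in both vertices, hence
   under translation by twice their difference [d]. Comparing the equations of
   [g] and [g + 2 d] for the generator [g] opposite to [d] forces [d = 0]. *)
Lemma cone_vertex_inj V V' u u' : u != 0 -> u' != 0 ->
  cone V u theta = cone V' u' theta -> V = V'.
Proof.
move=> u0 u'0 CE; have [d dE] : exists d, V' = V + d.
  by exists (V' - V); rewrite addrC subrK.
suff d0 : d = 0 by rewrite dE d0 addr0.
have c0 := cos_half_bloom_gt0; have s0 := sin_half_bloom_gt0.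
have csE := cos2Dsin2 (theta / 2).
have c2_lt1 : cos (theta / 2) ^+ 2 < 1.
  by rewrite -[X in _ < X]csE ltrDl exprn_gt0.
have c2_gt0 : 0 < cos (theta / 2) ^+ 2 by rewrite exprn_gt0.
have trans g : cone V u theta (V + g) -> cone V u theta (V + (g + (d + d))).
  move=> /(coneN u0); rewrite CE (_ : V - g = V' + (- g - d)); last first.
    by rewrite dE addrACA subrr addr0.
  move=> /(coneN u'0); rewrite -CE opprB opprK dE.
  by rewrite [g + _]addrC -!addrA.
have {}trans g : cone V u theta (V + g) ->
    cone V u theta (V + (g + 2 *: d)).
  by rewrite scaler_nat mulr2n; apply: trans.
move: (cos (theta / 2) ^+ 2) c2_lt1 c2_gt0 mem_cone_addr => c c_lt1 c_gt0 memE.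
have N0 : 0 < dotv u u by rewrite dotv_gt0.
(* Translating the vertex itself by [2 d] shows that [d] is a generator direction. *)
have dC : dotv d u ^+ 2 = c * dotv u u * dotv d d.
  have /trans : cone V u theta (V + 0).
    by rewrite memE // !dotv0l expr0n mulr0.
  rewrite memE // add0r !dotv_lin => E.
  have four : (4 : R) != 0 by rewrite pnatr_eq0.
  apply: (mulfI four); transitivity ((2 * dotv d u) ^+ 2); first by ring.
  by rewrite E; ring.
(* [|u|^2] times the image of [d] under the half-turn about the axis. *)
pose g := - dotv u u *: d + (2 * dotv d u) *: u.
have gu : dotv g u = dotv u u * dotv d u by rewrite /g !dotv_lin; ring.
have gd : dotv g d = - dotv u u * dotv d d + 2 * dotv d u ^+ 2.
  by rewrite /g !dotv_lin (dotvC u d); ring.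
have gg : dotv g g = dotv u u ^+ 2 * dotv d d.
  by rewrite /g !dotv_lin (dotvC u d); ring.
have gC : cone V u theta (V + g).
  by rewrite memE // gu gg exprMn dC; ring.
clearbody g; move: gC => /trans.
rewrite memE // !dotvDl !dotvDr !dotvZl !dotvZr.
rewrite (dotvC d g) gu gg gd => E.
apply/eqP; rewrite -dotv_eq0; apply/eqP.
(* The two sides of [E] differ by this factor times [|d|^2]; it is nonzero since [0 < c < 1]. *)
have D0 : 8 * c * dotv u u ^+ 2 * (1 - c) != 0.
  have cN : 1 - c != 0 by rewrite subr_eq0 gt_eqF.
  by rewrite !mulf_neq0 ?pnatr_eq0 ?(lt0r_neq0 c_gt0) ?(lt0r_neq0 N0).
apply: (mulfI D0); rewrite mulr0.
move/eqP: E; rewrite -subr_eq0 => /eqP E.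
rewrite -[RHS]E.
transitivity ((dotv u u + 2) ^+ 2 * dotv d u ^+ 2 - c * dotv u u *
  (dotv u u ^+ 2 * dotv d d
   + 4 * (- dotv u u * dotv d d + 2 * dotv d u ^+ 2) + 4 * dotv d d)).
  by rewrite dC; ring.
by ring.
Qed.

End Cones.

(** * Classification, count and axes of the orbit cones *)

Section OrbitCones.
Context {R : realType} {M H b e theta : R} {l A : 'rV[R]_3} {r : R -> 'rV[R]_3}.
Hypotheses (theta_bd : 0 < theta < pi) (M0 : 0 < M) (H0 : H < 0) (b0 : 0 < b)
  (e0 : 0 < e) (l0 : l != 0) (A0 : A != 0) (lA : dotv l A = 0).
Hypothesis aE : dotv A A = M ^+ 2 + H * dotv l l.
Hypothesis bE : cos (theta / 2) ^+ 2 * dotv l l =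
  b ^+ 2 * (M ^+ 2 - cos (theta / 2) ^+ 2 * dotv A A).
Hypothesis eE : e ^+ 2 * (1 + H * b ^+ 2) = b ^+ 2.
Hypothesis rl : forall t, dotv (r t) l = 0.
Hypothesis rA : forall t, M * enorm (r t) = dotv l l - dotv A (r t).
Hypothesis r_range : exists p q, p < q /\
  forall x, p <= x <= q -> exists t, dotv A (r t) = x.

Let L0 : 0 < dotv l l. Proof. exact: dotv_gt0. Qed.
Let a0 : 0 < dotv A A. Proof. exact: dotv_gt0. Qed.

Lemma dotv_frame p1 p2 p3 q1 q2 q3 :
  dotv (p1 *: A + p2 *: crossv l A + p3 *: l)
       (q1 *: A + q2 *: crossv l A + q3 *: l) =
  dotv A A * (p1 * q1) + dotv l l * dotv A A * (p2 * q2)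
  + dotv l l * (p3 * q3).
Proof.
rewrite !dotv_lin lagrange_identity.
rewrite (dotvC A (crossv _ _)) (dotvC l (crossv _ _)).
by rewrite dotv_crossl dotv_crossr (dotvC A l) lA; ring.
Qed.

Lemma orbit_frame t :
  exists y, r t = (dotv A (r t) / dotv A A) *: A + y *: crossv l A.
Proof.
have [x [y [z rE]]] := frame_decomp (r t) lA l0 A0; exists y.
have z0 : z = 0.
  have := rl t; rewrite rE !dotv_lin dotv_crossl (dotvC A l) lA !mulr0 !add0r.
  by move=> /eqP; rewrite mulf_eq0 (gt_eqF L0) orbF => /eqP.
rewrite rE z0 scale0r addr0 !dotv_lin (dotvC A (crossv _ _)) dotv_crossr mulr0.
by rewrite addr0 mulfK // gt_eqF.
Qed.

Definition cone_axis (tau : bool) := l + ((-1) ^+ tau * b) *: A.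

Definition cone_vertex (s tau : bool) :=
  vertex_coord H b e ((-1) ^+ s) *: A - ((-1) ^+ tau * ((-1) ^+ s * e)) *: l.

Lemma cone_axis_neq0 tau : cone_axis tau != 0.
Proof.
apply/negP => /eqP /(congr1 (dotv l)).
rewrite /cone_axis !dotv_lin lA mulr0 addr0.
by rewrite dotvC dotv0l; apply/eqP; rewrite gt_eqF.
Qed.

Lemma mem_cone_frame u1 u2 u3 v1 v2 v3 x y :
  let u := u1 *: A + u2 *: crossv l A + u3 *: l in
  u != 0 ->
  cone (v1 *: A + v2 *: crossv l A + v3 *: l) u theta
    (x *: A + y *: crossv l A) <->
  cone_poly (dotv l l) (dotv A A) (cos (theta / 2) ^+ 2) u1 u2 u3 v1 v2 v3 x y
  = 0.
Proof.
move=> u u0; rewrite mem_cone //.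
have -> : x *: A + y *: crossv l A - (v1 *: A + v2 *: crossv l A + v3 *: l) =
    (x - v1) *: A + (y - v2) *: crossv l A + (- v3) *: l.
  by move: (crossv l A) => W; apply/rowP => i; rewrite !mxE; ring.
rewrite !dotv_frame; set lhs := (X in X = _ <-> _).
set rhs := (X in _ = X <-> _).
have -> : cone_poly (dotv l l) (dotv A A) (cos (theta / 2) ^+ 2)
    u1 u2 u3 v1 v2 v3 x y = lhs - rhs.
  by rewrite /cone_poly /lhs /rhs; ring.
by split=> [->|/eqP]; [rewrite subrr|rewrite subr_eq0 => /eqP].
Qed.

Lemma orbit_ellipse x y t : r t = x *: A + y *: crossv l A ->
  ellipse M (dotv l l) (dotv A A) x y.
Proof.
move=> rE; have := rA t => /(congr1 (fun z => z ^+ 2)).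
rewrite exprMn sqr_enorm rE !dotv_lin lagrange_identity.
rewrite (dotvC A (crossv _ _)) dotv_crossr lA => E.
rewrite /ellipse [RHS](_ : _ = (dotv l l - (x * dotv A A + y * 0)) ^+ 2).
  by rewrite -E; ring.
by ring.
Qed.

(** The factor [q] reflects that a cone determines the direction of its axis only up to scaling. *)
Lemma lies_on_cone V u : u != 0 -> lies_on r (cone V u theta) <->
  exists s tau q, [/\ q != 0, V = cone_vertex s tau & u = q *: cone_axis tau].
Proof.
move=> u0.
have c2_gt0 : 0 < cos (theta / 2) ^+ 2 by rewrite exprn_gt0 ?cos_half_bloom_gt0.
have [u1 [u2 [u3 uE]]] := frame_decomp u lA l0 A0.
have [v1 [v2 [v3 vE]]] := frame_decomp V lA l0 A0.
split=> [rC|[s [tau [q [q0 -> ->]]]] t]; last first.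
  rewrite coneZ ?cone_axis_neq0 //; have [y rE] := orbit_frame t.
  have xy := orbit_ellipse rE; rewrite rE.
  have -> : cone_vertex s tau = vertex_coord H b e ((-1) ^+ s) *: A
      + 0 *: crossv l A + (- ((-1) ^+ tau * ((-1) ^+ s * e))) *: l.
    by rewrite scale0r addr0 scaleNr.
  have nE : cone_axis tau = ((-1) ^+ tau * b) *: A + 0 *: crossv l A + 1 *: l.
    by rewrite scale0r addr0 scale1r addrC.
  rewrite nE; apply/mem_cone_frame; first by rewrite -nE cone_axis_neq0.
  by apply: (cone_poly_ellipse H0 b0 aE bE eE _ _ xy); rewrite sqrr_sign.
have [p [q [pq pqr]]] := r_range.
pose S x y := exists t, r t = x *: A + y *: crossv l A.
have S_range x : p / dotv A A <= x <= q / dotv A A -> exists y, S x y.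
  rewrite ler_pdivrMr // ler_pdivlMr // => /pqr[t rt].
  have [y] := orbit_frame t; rewrite rt mulfK ?gt_eqF // => rE.
  by exists y, t.
have pq' : p / dotv A A < q / dotv A A by rewrite ltr_pM2r ?invr_gt0.
have [s [tau [[u30 u1E u20] [v1E v20 v3E]]]] :
    exists s tau : bool, [/\ u3 != 0, u1 = (-1) ^+ tau * b * u3 & u2 = 0] /\
    [/\ v1 = vertex_coord H b e ((-1) ^+ s), v2 = 0 &
        v3 = - ((-1) ^+ tau * ((-1) ^+ s * e))].
  apply: (orbit_cone_coord M0 L0 a0 H0 c2_gt0 b0 aE bE eE pq' S_range).
  - by move=> x y [t]; apply: orbit_ellipse.
  - by case=> u10 u20 u30; move/eqP: u0; rewrite uE u10 u20 u30 !scale0r !addr0.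
  - move=> x y [t rE]; apply/mem_cone_frame; first by rewrite -uE.
    by rewrite -uE -vE -rE; apply: rC.
exists s, tau, u3; split => //.
  by rewrite vE v1E v20 v3E scale0r addr0 scaleNr.
rewrite uE u1E u20 scale0r addr0 /cone_axis scalerDr scalerA addrC.
by rewrite (mulrC u3).
Qed.

Lemma dotv_frame2 p q : (dotv A (p *: A + q *: l) = p * dotv A A) *
  (dotv l (p *: A + q *: l) = q * dotv l l).
Proof. by rewrite !dotv_lin lA (dotvC A l) lA !mulr0 addr0 add0r. Qed.

Lemma frame2_inj p q p' q' : p *: A + q *: l = p' *: A + q' *: l ->
  p = p' /\ q = q'.
Proof.
move=> E; split.
  apply: (mulIf (lt0r_neq0 a0)).
  by rewrite -(dotv_frame2 p q).1 E (dotv_frame2 p' q').1.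
apply: (mulIf (lt0r_neq0 L0)).
by rewrite -(dotv_frame2 p q).2 E (dotv_frame2 p' q').2.
Qed.

Lemma cone_vertex_coord_inj s tau s' tau' :
  cone_vertex s tau = cone_vertex s' tau' -> s = s' /\ tau = tau'.
Proof.
rewrite /cone_vertex -![- (_ *: l)]scaleNr => /frame2_inj[E1 E2].
have {}E2 := oppr_inj E2.
have ss : s = s'.
  move: E1; rewrite /vertex_coord => /mulIf.
  rewrite invr_eq0 => /(_ (ltr0_neq0 H0)).
  move=> /addrI /mulIf; rewrite invr_eq0 => /(_ (lt0r_neq0 b0)).
  by move=> /(mulIf (lt0r_neq0 e0)) /signr_inj.
split=> //; move: E2; rewrite ss => /mulIf.
by rewrite mulf_neq0 ?signr_eq0 ?lt0r_neq0 // => /(_ isT) /signr_inj.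
Qed.

Definition orbit_cone (s tau : bool) : set 'rV[R]_3 :=
  cone (cone_vertex s tau) (cone_axis tau) theta.

Lemma orbit_cone_inj s tau s' tau' :
  orbit_cone s tau = orbit_cone s' tau' -> s = s' /\ tau = tau'.
Proof.
move=> /(cone_vertex_inj theta_bd (cone_axis_neq0 _) (cone_axis_neq0 _)).
exact: cone_vertex_coord_inj.
Qed.

Lemma lies_on_orbit_cone s tau : lies_on r (orbit_cone s tau).
Proof.
apply/lies_on_cone; first exact: cone_axis_neq0.
by exists s, tau, 1; rewrite scale1r oner_neq0.
Qed.

Lemma orbit_cones_card : (orbit_cones r theta #= `I_4)%card.
Proof.
(* The two binary digits of [i < 4] are the two signs. *)
pose f (i : nat) := orbit_cone (odd i) (odd i./2).
have -> : orbit_cones r theta = f @` `I_4.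
  apply/seteqP; split=> [C [rC [V [D [_ [u u0 [_ CE]]]]]]|_ [i _ <-]].
    move: rC; rewrite CE => /(lies_on_cone _ u0)[s [tau [q [q0 -> ->]]]].
    rewrite coneZ ?cone_axis_neq0 //; exists (s + tau.*2)%N.
      by case: s; case: tau.
    by case: s; case: tau.
  split; first exact: lies_on_orbit_cone.
  exists (cone_vertex (odd i) (odd i./2)); eexists; split=> //.
  by exists (cone_axis (odd i./2)); first exact: cone_axis_neq0.
apply: inj_card_eq => i j; rewrite !inE /= => i4 j4 /orbit_cone_inj[E1 E2].
by move: i4 j4 E1 E2; case: i => [|[|[|[|?]]]] //; case: j => [|[|[|[|?]]]].
Qed.

(** The alpha of the theorem for the sign [s] of epsilon: here the axis crosses the orbit plane. *)
Definition axis_coord (s : bool) := (1 + ((-1) ^+ s * e)^-1 * b) / H.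

(** By [eE], [b / e - e / b = H e b], which relates the crossing point of the axis to the vertex. *)
Lemma axis_coordE s :
  axis_coord s = vertex_coord H b e ((-1) ^+ s) + (-1) ^+ s * e * b.
Proof.
have e0' := lt0r_neq0 e0; have b0' := lt0r_neq0 b0; have H0' := ltr0_neq0 H0.
rewrite /axis_coord /vertex_coord invfM invr_sign; move: ((-1) ^+ s) => z.
apply: (mulIf H0'); rewrite divfK // mulrDl divfK //.
apply: (mulIf (mulf_neq0 (mulf_neq0 b0' e0') e0')).
transitivity (b * e ^+ 2 + z * e * b ^+ 2); first by field.
by rewrite -eE; field.
Qed.

(** The displacement of the vertex along the axis carries the sign of epsilon: for both [tau], the
    [A]-coordinate decreases by [e b] when epsilon is positive and increases by [e b] when it is
    negative. *)
Lemma cone_vertexE s tau : cone_vertex s tau =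
  axis_coord s *: A - ((-1) ^+ tau * ((-1) ^+ s * e)) *: cone_axis tau.
Proof.
rewrite /cone_vertex /cone_axis axis_coordE.
have : (-1) ^+ tau * (-1) ^+ tau = 1 :> R by rewrite -expr2 sqrr_sign.
move: ((-1) ^+ tau) => t t2; apply/rowP => i; rewrite !mxE.
transitivity (vertex_coord H b e ((-1) ^+ s) * A 0 i
  - t * ((-1) ^+ s * e) * l 0 i
  + (1 - t * t) * ((-1) ^+ s * e * b * A 0 i)); last by ring.
by rewrite t2 subrr mul0r addr0.
Qed.

Lemma axis_coord_inj : injective axis_coord.
Proof.
move=> s s'; rewrite /axis_coord => /mulIf; rewrite invr_eq0.
move=> /(_ (ltr0_neq0 H0)) /addrI /(mulIf (lt0r_neq0 b0)) /invr_inj.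
by move=> /(mulIf (lt0r_neq0 e0)) /signr_inj.
Qed.

Lemma is_cone_orbit_cone s tau : exists D,
  is_cone (orbit_cone s tau) (cone_vertex s tau) D theta /\
  D (axis_coord s *: A).
Proof.
exists (line (cone_vertex s tau) (cone_axis tau)); split.
  by split=> //; exists (cone_axis tau); first exact: cone_axis_neq0.
exists ((-1) ^+ tau * ((-1) ^+ s * e)) => //.
by rewrite cone_vertexE subrK.
Qed.

(** Each axis has a nonzero [l]-component, so it meets the line spanned by [A] only once, at a point
    that depends on [s] but not on [tau]. Hence [s] is determined and both [tau] occur. *)
Lemma orbit_cones_throughE s :
  orbit_cones_through r theta (axis_coord s *: A) =
  [set orbit_cone s false; orbit_cone s true].
Proof.
have sub tau :
    orbit_cones_through r theta (axis_coord s *: A) (orbit_cone s tau).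
  split; first exact: lies_on_orbit_cone.
  by have [D [? ?]] := is_cone_orbit_cone s tau; exists (cone_vertex s tau), D.
apply/seteqP; split=> [C|C [->|->]]; [|exact: sub|exact: sub].
move=> [rC [V [D [[_ [u u0 [-> CE]]] [p _ VpuE]]]]].
move: rC; rewrite CE => /(lies_on_cone _ u0)[s' [tau [q [q0 VE uE]]]].
move: VpuE; rewrite VE uE => VpuE.
have ss : s' = s.
  have : axis_coord s *: A + 0 *: l =
      (vertex_coord H b e ((-1) ^+ s') + p * q * ((-1) ^+ tau * b)) *: A
      + (p * q - (-1) ^+ tau * ((-1) ^+ s' * e)) *: l.
    rewrite scale0r addr0 -VpuE /cone_vertex /cone_axis.
    by apply/rowP => i; rewrite !mxE; ring.
  move=> /frame2_inj[E1 /eqP]; rewrite eq_sym subr_eq0 => /eqP E2.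
  apply: axis_coord_inj; rewrite E1 axis_coordE E2; congr (_ + _).
  transitivity (((-1) ^+ tau) ^+ 2 * ((-1) ^+ s' * e * b)).
    by rewrite sqrr_sign mul1r.
  by ring.
rewrite ss coneZ ?cone_axis_neq0 //.
by case: (tau); [right|left].
Qed.

End OrbitCones.

(** * The arc covered by the orbit, and the theorem *)

Lemma dotv_lrl_position_range {R : realType} (m k : R) (r : R -> 'rV[R]_3) t0 :
  kepler_solution k r -> 0 < m -> k != 0 ->
  angular_momentum m r t0 != 0 -> lrl_vector m k r t0 != 0 ->
  exists p q, p < q /\ forall x, p <= x <= q ->
    exists t, dotv (lrl_vector m k r t0) (r t) = x.
Proof.
move=> rK m0 k0 l0 A0; set A := lrl_vector m k r t0.
have : exists t, dotv A (r t) <> dotv A (r t0).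
  apply: contrapT => /forallNP E.
  apply: (lrl_position_nonconst rK m0 k0 l0 A0 (c := dotv A (r t0))) => t.
  exact: contrapT (E t).
have cont (u w : R) : {within `[u, w], continuous (fun s => dotv A (r s))}.
  apply: continuous_subspaceT => t; exact: continuous_dotv_position rK A t.
have ivt t1 t2 : dotv A (r t1) < dotv A (r t2) -> exists p q, p < q /\
    forall x, p <= x <= q -> exists t, dotv A (r t) = x.
  move=> t12; exists (dotv A (r t1)), (dotv A (r t2)); split=> // x xb.
  have [le_t|/ltW t21] := leP t1 t2; last first.
    have [|t _ <-] := @IVT _ (fun s => dotv A (r s)) t2 t1 x t21 (cont _ _).
      by rewrite minC maxC minElt maxElt t12.
    by exists t.
  have [|t _ <-] := @IVT _ (fun s => dotv A (r s)) t1 t2 x le_t (cont _ _).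
    by rewrite minElt maxElt t12.
  by exists t.
by move=> [t1 /eqP/lt_total/orP[]]; apply: ivt.
Qed.

Theorem theorem4p3 (R : realType) (m k : R) (r : R -> 'rV[R]_3)
  (t0 theta beta : R)
  (l := angular_momentum m r t0) (h := energy m k r t0)
  (A := lrl_vector m k r t0) (rho := tan (theta / 2))
  (eps := fun s : bool => (-1) ^+ s * (enorm l / (m ^+ 2 * k * rho)))
  (alpha := fun s : bool => (1 + (eps s)^-1 * `|beta|) / (2 * m * h)) :
  0 < m -> 0 < k -> kepler_solution k r ->
  h < 0 -> l != 0 -> h <> - (m ^+ 3 * k ^+ 2 / (2 * enorm l ^+ 2)) ->
  0 < theta < pi ->
  (forall s, beta ^+ 2 = - 1 / (2 * m * h - (eps s) ^- 2)) ->
  [/\ alpha false <> alpha true,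
      (orbit_cones r theta #= `I_4)%card &
      forall s, exists C1 C2,
        [/\ C1 <> C2,
            orbit_cones_through r theta (alpha s *: A) = [set C1; C2],
            (exists D1, is_cone C1
               (alpha s *: A - eps s *: (l + `|beta| *: A)) D1 theta /\
               D1 (alpha s *: A)) &
            (exists D2, is_cone C2
               (alpha s *: A + eps s *: (l - `|beta| *: A)) D2 theta /\
               D2 (alpha s *: A))]].
Proof.
move=> m0 k0 rK h0 l0 h_noncirc theta_bd beta2.
have c0 := cos_half_bloom_gt0 theta_bd; have s0 := sin_half_bloom_gt0 theta_bd.
have csE := cos2Dsin2 (theta / 2).
have rho0 : 0 < rho by rewrite /rho /tan divr_gt0.
have rhoE : rho ^+ 2 * cos (theta / 2) ^+ 2 = 1 - cos (theta / 2) ^+ 2.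
  rewrite -[X in _ = X - _]csE addrAC subrr add0r -exprMn /rho /tan.
  by rewrite divfK // gt_eqF.
set M := m ^+ 2 * k; have M0 : 0 < M by rewrite mulr_gt0 ?exprn_gt0.
set H := 2 * m * h.
have H0 : H < 0 by rewrite /H pmulr_rlt0 ?mulr_gt0.
set e := enorm l / (M * rho).
have L0 := enorm_gt0 l0.
have e0 : 0 < e := divr_gt0 L0 (mulr_gt0 M0 rho0).
have epsE s : eps s = (-1) ^+ s * e := erefl.
(* Negative energy keeps the denominator of [beta ^+ 2] away from 0. *)
have D0 : 0 < e ^- 2 - H by rewrite addr_gt0 ?oppr_gt0 ?invr_gt0 ?exprn_gt0.
have beta2E : `|beta| ^+ 2 * (e ^- 2 - H) = 1.
  rewrite real_normK ?num_real // (beta2 false) epsE expr0 mul1r -/H.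
  have HD0 : H - e ^- 2 != 0 by rewrite -oppr_eq0 opprB lt0r_neq0.
  by rewrite -[X in _ * X]opprB mulrN divfK // opprK.
have b0 : 0 < `|beta|.
  rewrite lt_neqAle normr_ge0 andbT; apply/negP => /eqP b0.
  by move: beta2E; rewrite -b0 expr0n mul0r => /eqP; rewrite eq_sym oner_eq0.
set b := `|beta| in beta2E b0 *.
have e2E : e ^+ 2 * (M ^+ 2 * rho ^+ 2) = dotv l l.
  rewrite -sqr_enorm -!exprMn /e divfK // mulf_neq0 ?gt_eqF //.
have eE : e ^+ 2 * (1 + H * b ^+ 2) = b ^+ 2.
  have e20 : e ^+ 2 != 0 by rewrite expf_neq0 ?gt_eqF.
  transitivity (e ^+ 2 * (b ^+ 2 * (e ^- 2 - H) + H * b ^+ 2)).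
    by rewrite beta2E.
  by field; rewrite gt_eqF.
have aE : dotv A A = M ^+ 2 + H * dotv l l by rewrite dotv_lrl_lrl.
(* [rho] is eliminated between [e^2 M^2 rho^2 = l^2] and [rho^2 cos^2 = 1 - cos^2]. *)
have bE : cos (theta / 2) ^+ 2 * dotv l l =
    b ^+ 2 * (M ^+ 2 - cos (theta / 2) ^+ 2 * dotv A A).
  have e2b : e ^+ 2 = b ^+ 2 * (1 - H * e ^+ 2) by rewrite mulrBr -{1}eE; ring.
  rewrite aE -e2E.
  transitivity (cos (theta / 2) ^+ 2 * (M ^+ 2 * rho ^+ 2) *
    (b ^+ 2 * (1 - H * e ^+ 2))); first by rewrite -e2b; ring.
  transitivity (b ^+ 2 * M ^+ 2 * (rho ^+ 2 * cos (theta / 2) ^+ 2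
    - H * e ^+ 2 * (rho ^+ 2 * cos (theta / 2) ^+ 2))); first by ring.
  by rewrite {1}rhoE; ring.
(* For [A = 0], [aE] reads [M^2 = - 2 m h l^2], the excluded energy. *)
have A0 : A != 0.
  apply/negP => /eqP A0; apply: h_noncirc; move: aE; rewrite A0 dotv0l.
  rewrite -sqr_enorm => E.
  have mL0 : 2 * m * enorm l ^+ 2 != 0.
    by rewrite !mulf_neq0 ?pnatr_eq0 ?expf_neq0 ?lt0r_neq0.
  apply: (mulfI mL0); transitivity (H * enorm l ^+ 2).
    by rewrite /H; ring.
  have /eqP := esym E; rewrite addrC addr_eq0 => /eqP ->.
  by rewrite /M; field; rewrite !lt0r_neq0.
have lA : dotv l A = 0 by apply: dotv_lrl_angular_momentum.
have rl t : dotv (r t) l = 0.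
  rewrite /l -(angular_momentum_const rK t t0).
  exact: dotv_position_angular_momentum.
have rA t : M * enorm (r t) = dotv l l - dotv A (r t).
  rewrite /l /A -(angular_momentum_const rK t t0) -(lrl_vector_const rK t t0).
  exact: dotv_lrl_position.
have rr := dotv_lrl_position_range rK m0 (lt0r_neq0 k0) l0 A0.
split.
(* [alpha s] unfolds to [axis_coord s], so the lemmas on [axis_coord] apply by conversion. *)
- move=> /(@axis_coord_inj _ H b e H0 b0 e0); discriminate.
- exact: (orbit_cones_card theta_bd M0 H0 b0 e0 l0 A0 lA aE bE eE rl rA rr).
- move=> s; exists (@orbit_cone _ H b e theta l A s false).
  exists (@orbit_cone _ H b e theta l A s true).
  have vertexE := cone_vertexE (l := l) (A := A) H0 b0 e0 eE s.
  have := vertexE false; rewrite /cone_axis expr0 !mul1r => <-.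
  have := vertexE true.
  rewrite /cone_axis expr1 !mulN1r scaleNr opprK scaleNr => <-.
  split.
  - by move=> /(orbit_cone_inj theta_bd H0 b0 e0 l0 A0 lA)[].
  - exact: (orbit_cones_throughE theta_bd M0 H0 b0 e0 l0 A0 lA aE bE eE
      rl rA rr).
  - exact: (is_cone_orbit_cone theta_bd H0 b0 e0 l0 lA eE).
  - exact: (is_cone_orbit_cone theta_bd H0 b0 e0 l0 lA eE).
Qed.
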